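(* Consider the inhomogeneous Aw-Rascle-Zhang (ARZ) traffic model in Lagrangian variables with functions $U,h$ satisfying the assumptions stated in the context. Let $v_S\in I$, put $m_S=-h'(v_S)$, and suppose that the non-degeneracy condition $U'(v_S)\neq m_S$ holds. Then there exists a jamiton with sonic value $v_S$ if and only if the base state solution $v\equiv v_S$, $u\equiv U(v_S)$ of the ARZ model is (linearly) unstable.
   Context: Setting. $I=(v_{\min},\infty)$ with $v_{\min}\ge 0$ is the interval of admissible specific volumes $v=1/\rho$ ($\rho$ is the vehicle density; typically $v_{\min}=1/\rho_{\max}$). The relaxation time is $\tau>0$. The desired velocity $U:I\to\mathbb{R}$ and the hesitation function $h:I\to\mathbb{R}$ are twice continuously differentiable functions of $v$ with $U'(v)>0$, $U''(v)<0$, $h'(v)<0$, $h''(v)>0$ for all $v\in I$ (primes denote $d/dv$). Inhomogeneous ARZ model in Lagrangian variables ($\sigma$ = vehicle number, $u$ = velocity): $$v_t-u_\sigma=0,\qquad (u+h(v))_t=\tfrac1\tau\,(U(v)-u).$$ Linear stability. The base state $(v,u)\equiv(v_S,U(v_S))$ is linearly stable if infinitesimal perturbations decay in time, i.e. if every nontrivial solution of the form $(V,W)e^{ik\sigma+\lambda t}$, with $k\in\mathbb{R}\setminus\{0\}$ and $(V,W)\in\mathbb{C}^2\setminus\{0\}$, of the system linearized about the base state satisfies $\operatorname{Re}\lambda<0$. It is unstable if it is not linearly stable. The non-degeneracy condition $U'(v_S)\ne m_S$ expresses that the characteristic velocity $\mu=Q'(\rho)$, with $Q(\rho)=\rho\,U$,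 of the reduced first order model $\rho_t+(Q(\rho))_x=0$ does not coincide with one of the two (Eulerian) characteristic velocities of the ARZ model at the base state. Jamiton. A jamiton with sonic value $v_S$ is a traveling wave in the self-similar variable $\chi=(mt+\sigma)/\tau$, where $m>0$ is the number with $h'(v_S)=-m$, that consists of a smooth part of finite length with an attached shock traveling at the same speed. Precisely, it is a pair of $C^1$ functions $(v(\chi),u(\chi))$ on a compact interval $[\chi^+,\chi^-]$, $\chi^+<\chi^-$, with $v$ taking values in $I$, such that: (1) $m v'(\chi)-u'(\chi)=0$ and $m u'(\chi)+m h'(v(\chi))v'(\chi)=U(v(\chi))-u(\chi)$ on $[\chi^+,\chi^-]$; (2) writing $(v^\pm,u^\pm)=(v(\chi^\pm),u(\chi^\pm))$, the shock with left state $(v^-,u^-)$ and right state $(v^+,u^+)$ satisfies the Rankine-Hugoniot conditions $m[v]-[u]=0$, $[u]+[h(v)]=0$, where $[z]$ is the jump of $z$ across the shock; (3) the shock satisfies the Lax entropy condition, which here reads $v^->v^+$. (Repeating such a profile periodically gives an infinite periodic chain of jamitons connected by shocks.) *)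

(* Defs.v *)
From Stdlib Require Import Reals.
From Coquelicot Require Import Coquelicot.
Open Scope R_scope.

(** Functions on the open interval I = (vmin, oo) are represented by total
    functions on R of which only the values on I are constrained. *)
Definition admissible (vmin v : R) : Prop := vmin < v.

Definition C2_on (I : R -> Prop) (f : R -> R) : Prop :=
  forall v, I v ->
    ex_derive_n f 1 v /\ ex_derive_n f 2 v /\ continuous (Derive_n f 2) v.

(** Fields depend on (sigma, t), in this order.  The ARZ system in Lagrangian
    variables says that both residuals vanish identically. *)
Definition arz_mass (v u : R -> R -> R) (sigma t : R) : R :=
  Derive (fun t' => v sigma t') t - Derive (fun s' => u s' t) sigma.

Definition arz_momentum (tau : R) (U h : R -> R) (v u : R -> R -> R)
    (sigma t : R) : R :=
  Derive (fun t' => u sigma t' + h (v sigma t')) t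
    - / tau * (U (v sigma t) - u sigma t).

(** [(p, q)] solves the system linearized about [(vS, U vS)]: the residuals of
    the perturbed state [(vS + eps p, U vS + eps q)] have vanishing first-order
    term in eps.  It is only applied below to smooth [p], [q]; at a fixed point
    [(sigma, t)], the perturbed volume takes values in I near that point
    as soon as eps is small. *)
Definition solves_linearized (tau : R) (U h : R -> R) (vS : R)
    (p q : R -> R -> R) : Prop :=
  let v eps sigma t := vS + eps * p sigma t in
  let u eps sigma t := U vS + eps * q sigma t in
  forall sigma t : R,
    is_derive (fun eps => arz_mass (v eps) (u eps) sigma t) 0 0 /\
    is_derive (fun eps => arz_momentum tau U h (v eps) (u eps) sigma t) 0 0.

Definition Cexp (z : C) : C := (exp (Re z) * cos (Im z), exp (Re z) * sin (Im z)).

Definition mode (k : R) (lambda A : C) (sigma t : R) : C :=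
  (A * Cexp (Ci * RtoC k * RtoC sigma + lambda * RtoC t))%C.

(** The linearized system has real coefficients, so a complex pair of fields
    solves it when its real and imaginary parts do. *)
Definition mode_solves_linearized (tau : R) (U h : R -> R) (vS : R)
    (k : R) (lambda V W : C) : Prop :=
  solves_linearized tau U h vS
    (fun sigma t => Re (mode k lambda V sigma t))
    (fun sigma t => Re (mode k lambda W sigma t)) /\
  solves_linearized tau U h vS
    (fun sigma t => Im (mode k lambda V sigma t))
    (fun sigma t => Im (mode k lambda W sigma t)).

Definition linearly_stable (tau : R) (U h : R -> R) (vS : R) : Prop :=
  forall (k : R) (lambda V W : C),
    k <> 0 -> (V, W) <> (RtoC 0, RtoC 0) ->
    mode_solves_linearized tau U h vS k lambda V W ->
    Re lambda < 0.

Definition linearly_unstable (tau : R) (U h : R -> R) (vS : R) : Prop :=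
  ~ linearly_stable tau U h vS.

(** [f] is C^1 on [a, b] with derivative [df]; [D_in] is the derivative relative
    to the interval, hence one-sided at the endpoints. *)
Definition C1_on_segment (a b : R) (f df : R -> R) : Prop :=
  let D x := a <= x <= b in
  forall x, D x -> D_in f df D x /\ continue_in df D x.

(** [v], [u] are functions of chi = (m t + sigma) / tau on
    [chip, chim] = [chi^+, chi^-]; in this rescaled variable the profile
    equations no longer involve tau. *)
Record is_jamiton (vmin : R) (U h : R -> R) (vS m chip chim : R)
    (v u dv du : R -> R) : Prop := {
  jamiton_speed_pos : 0 < m;
  jamiton_sonic : Derive h vS = - m;
  jamiton_length : chip < chim;
  jamiton_v_C1 : C1_on_segment chip chim v dv;
  jamiton_u_C1 : C1_on_segment chip chim u du;
  jamiton_admissible : forall chi, chip <= chi <= chim -> admissible vmin (v chi);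
  jamiton_mass : forall chi, chip <= chi <= chim -> m * dv chi - du chi = 0;
  jamiton_momentum : forall chi, chip <= chi <= chim ->
    m * du chi + m * Derive h (v chi) * dv chi = U (v chi) - u chi;
  jamiton_RH_mass : m * (v chip - v chim) - (u chip - u chim) = 0;
  jamiton_RH_momentum : (u chip - u chim) + (h (v chip) - h (v chim)) = 0;
  jamiton_Lax : v chip < v chim
}.

Definition jamiton_exists (vmin : R) (U h : R -> R) (vS : R) : Prop :=
  exists (m chip chim : R) (v u dv du : R -> R),
    is_jamiton vmin U h vS m chip chim v u dv du.

(* Main.v *)
Require Import Defs.
From Stdlib Require Import Reals.
From Coquelicot Require Import Coquelicot.
From Stdlib Require Import Lra Psatz Ranalysis5.
Open Scope R_scope.

(** Write [m = - h'(vS)].  Both sides of the equivalence amount to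
    [m < U'(vS)].

    For a mode, the linearized system reduces to the dispersion relation
    [l^2 + l (1/tau - i k m) - i k U'(vS) / tau = 0], whose real and imaginary
    parts decide the sign of [Re l].

    A traveling wave has [u = m v + c], and the shock conditions say that
    [r(v) = m v + h(v)], which is convex with minimum at [vS], takes the same
    value at both ends.  Hence the profile crosses [vS], which forces
    [c = U(vS) - m vS] and [m r'(v) v' = U(v) - m v - c].  If [U'(vS) < m], then
    [v' < 0] wherever [v > vS], which is impossible at the maximum of [v].  If
    [m < U'(vS)], both sides of the equation vanish to first order at [vS] with
    a positive ratio, so [chi] is locally an increasing function of [v]; its
    inverse, cut between two nearby points of equal [r], is a jamiton. *)

(** * Linearization of the ARZ residuals about the base state *)

Lemma C2_on_is_derive (I : R -> Prop) (f : R -> R) (x : R) :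
  C2_on I f -> I x -> is_derive f x (Derive f x).
Proof.
  intros hf hx; apply Derive_correct; exact (proj1 (hf x hx)).
Qed.

Lemma C2_on_is_derive2 (I : R -> Prop) (f : R -> R) (x : R) :
  C2_on I f -> I x -> is_derive (Derive f) x (Derive_n f 2 x).
Proof.
  intros hf hx; apply Derive_correct; exact (proj1 (proj2 (hf x hx))).
Qed.

Lemma locally_admissible_perturbation (vmin vS c : R) :
  admissible vmin vS -> locally 0 (fun eps => admissible vmin (vS + eps * c)).
Proof.
  unfold admissible; intros hv.
  assert (hc : continuous (fun eps => vS + eps * c) 0).
  { apply (ex_derive_continuous (K := R_AbsRing) (V := R_NormedModule)).
    auto_derive; trivial. }
  apply (hc (fun y => vmin < y)).
  replace (vS + 0 * c) with vS by ring.
  exact (open_gt vmin vS hv).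
Qed.

(** The mass residual is exactly linear in [eps]. The momentum residual is expanded by the chain
    rule; the term with [h''] carries a factor [eps] and drops out at 0. *)
Lemma solves_linearized_iff (vmin tau : R) (U h : R -> R) (vS : R)
  (p q pt qt qs : R -> R -> R) :
  C2_on (admissible vmin) U -> C2_on (admissible vmin) h ->
  admissible vmin vS ->
  (forall s t, is_derive (fun t' => p s t') t (pt s t)) ->
  (forall s t, is_derive (fun t' => q s t') t (qt s t)) ->
  (forall s t, is_derive (fun s' => q s' t) s (qs s t)) ->
  solves_linearized tau U h vS p q <->
  forall s t, pt s t - qs s t = 0 /\
    qt s t + Derive h vS * pt s t - / tau * (Derive U vS * p s t - q s t) = 0.
Proof.
  intros hU hh hv hpt hqt hqs.
  assert (E1 : forall s t, is_derive
    (fun eps => arz_mass (fun s t => vS + eps * p s t)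
                 (fun s t => U vS + eps * q s t) s t) 0 (pt s t - qs s t)).
  { intros s t.
    apply (is_derive_ext (fun eps => eps * (pt s t - qs s t))).
    - intros eps; unfold arz_mass; symmetry; rewrite Rmult_minus_distr_l.
      f_equal; apply is_derive_unique.
      + evar_last; [apply (is_derive_plus (fun _ => vS));
          [apply is_derive_const | apply is_derive_scal, hpt] |].
        unfold plus, zero; simpl; ring.
      + evar_last; [apply (is_derive_plus (fun _ => U vS));
          [apply is_derive_const | apply is_derive_scal, hqs] |].
        unfold plus, zero; simpl; ring.
    - auto_derive; trivial; ring. }
  assert (E2 : forall s t, is_derive
    (fun eps => arz_momentum tau U h (fun s t => vS + eps * p s t)
                 (fun s t => U vS + eps * q s t) s t) 0
    (qt s t + Derive h vS * pt s t - / tau * (Derive U vS * p s t - q s t))).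
  { intros s t.
    (* The closed form holds only near [eps = 0]: [h] is known to be differentiable at the perturbed
       volume only where that volume lies in I. *)
    apply (is_derive_ext_loc (fun eps =>
      eps * qt s t + Derive h (vS + eps * p s t) * (eps * pt s t)
      - / tau * (U (vS + eps * p s t) - (U vS + eps * q s t)))).
    - generalize (locally_admissible_perturbation vmin vS (p s t) hv).
      apply filter_imp; intros eps heps; unfold arz_momentum; f_equal.
      symmetry; apply is_derive_unique.
      evar_last.
      { apply (is_derive_plus (fun t' => U vS + eps * q s t')).
        - apply (is_derive_plus (fun _ => U vS));
            [apply is_derive_const | apply is_derive_scal, hqt].
        - apply (is_derive_comp h (fun t' => vS + eps * p s t')).
          + apply C2_on_is_derive with (1 := hh); exact heps.
          + apply (is_derive_plus (fun _ => vS));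
            [apply is_derive_const | apply is_derive_scal, hpt]. }
      unfold plus, zero, scal; simpl; unfold mult; simpl; ring.
    - assert (hlin : is_derive (fun eps => vS + eps * p s t) 0 (p s t))
        by (auto_derive; trivial; ring).
      assert (h0 : vS + 0 * p s t = vS) by ring.
      assert (dU : is_derive (fun eps => U (vS + eps * p s t)) 0 (p s t * Derive U vS)).
      { apply (is_derive_comp U (fun eps => vS + eps * p s t)); trivial.
        rewrite h0; apply C2_on_is_derive with (1 := hU); exact hv. }
      assert (dh : is_derive (fun eps => Derive h (vS + eps * p s t)) 0
                     (p s t * Derive_n h 2 vS)).
      { apply (is_derive_comp (Derive h) (fun eps => vS + eps * p s t)); trivial.
        rewrite h0; apply C2_on_is_derive2 with (1 := hh); exact hv. }
      assert (dm := is_derive_mult (fun eps => Derive h (vS + eps * p s t))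
        (fun eps => eps * pt s t) 0 _ (pt s t) dh
        ltac:(auto_derive; trivial; ring) Rmult_comm).
      assert (dq : is_derive (fun eps => eps * qt s t) 0 (qt s t))
        by (auto_derive; trivial; ring).
      assert (ds := is_derive_minus (fun eps => U (vS + eps * p s t))
        (fun eps => U vS + eps * q s t) 0 _ (q s t) dU
        ltac:(auto_derive; trivial; ring)).
      evar_last.
      { exact (is_derive_minus _ _ _ _ _ (is_derive_plus _ _ _ _ _ dq dm)
                 (is_derive_scal _ _ (/ tau) _ ds)). }
      unfold minus, plus, opp, scal; simpl; unfold mult; simpl.
      rewrite h0; ring. }
  unfold solves_linearized; split; intros H s t; specialize (H s t);
    specialize (E1 s t); specialize (E2 s t).
  - destruct H as [H1 H2]; split.
    + rewrite <- (is_derive_unique _ _ _ E1); exact (is_derive_unique _ _ _ H1).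
    + rewrite <- (is_derive_unique _ _ _ E2); exact (is_derive_unique _ _ _ H2).
  - destruct H as [H1 H2]; split.
    + rewrite H1 in E1; exact E1.
    + rewrite H2 in E2; exact E2.
Qed.

(** * Fourier modes and their amplitude equations *)

Lemma Re_mode (k : R) (l A : C) (s t : R) :
  Re (mode k l A s t) = exp (Re l * t) *
    (Re A * cos (k * s + Im l * t) - Im A * sin (k * s + Im l * t)).
Proof.
  destruct l as [a b], A as [x y]; unfold mode, Cexp, Cmult, Cplus, RtoC, Ci, Re, Im; simpl.
  replace ((0 * k - 1 * 0) * s - (0 * 0 + 1 * k) * 0 + (a * t - b * 0)) with (a * t) by ring.
  replace ((0 * k - 1 * 0) * 0 + (0 * 0 + 1 * k) * s + (a * 0 + b * t)) with (k * s + b * t) by ring.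
  ring.
Qed.

Lemma Im_mode (k : R) (l A : C) (s t : R) :
  Im (mode k l A s t) = exp (Re l * t) *
    (Re A * sin (k * s + Im l * t) + Im A * cos (k * s + Im l * t)).
Proof.
  destruct l as [a b], A as [x y]; unfold mode, Cexp, Cmult, Cplus, RtoC, Ci, Re, Im; simpl.
  replace ((0 * k - 1 * 0) * s - (0 * 0 + 1 * k) * 0 + (a * t - b * 0)) with (a * t) by ring.
  replace ((0 * k - 1 * 0) * 0 + (0 * 0 + 1 * k) * s + (a * 0 + b * t)) with (k * s + b * t) by ring.
  ring.
Qed.

(** Writing the derivative again as a [mode], with only the amplitude changed, allows each
    linearized residual to be collected later into a single mode. *)
Lemma is_derive_Re_mode_t (k : R) (l A : C) (s t : R) :
  is_derive (fun t' => Re (mode k l A s t')) t (Re (mode k l (l * A)%C s t)).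
Proof.
  apply (is_derive_ext _ _ _ _ (fun t' => eq_sym (Re_mode k l A s t'))).
  rewrite Re_mode; destruct l as [a b], A as [x y]; unfold Re, Im; simpl.
  auto_derive; trivial; ring.
Qed.

Lemma is_derive_Im_mode_t (k : R) (l A : C) (s t : R) :
  is_derive (fun t' => Im (mode k l A s t')) t (Im (mode k l (l * A)%C s t)).
Proof.
  apply (is_derive_ext _ _ _ _ (fun t' => eq_sym (Im_mode k l A s t'))).
  rewrite Im_mode; destruct l as [a b], A as [x y]; unfold Re, Im; simpl.
  auto_derive; trivial; ring.
Qed.

Lemma is_derive_Re_mode_s (k : R) (l A : C) (s t : R) :
  is_derive (fun s' => Re (mode k l A s' t)) s
    (Re (mode k l (Ci * RtoC k * A)%C s t)).
Proof.
  apply (is_derive_ext _ _ _ _ (fun s' => eq_sym (Re_mode k l A s' t))).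
  rewrite Re_mode; destruct l as [a b], A as [x y]; unfold Re, Im; simpl.
  auto_derive; trivial; ring.
Qed.

Lemma is_derive_Im_mode_s (k : R) (l A : C) (s t : R) :
  is_derive (fun s' => Im (mode k l A s' t)) s
    (Im (mode k l (Ci * RtoC k * A)%C s t)).
Proof.
  apply (is_derive_ext _ _ _ _ (fun s' => eq_sym (Im_mode k l A s' t))).
  rewrite Im_mode; destruct l as [a b], A as [x y]; unfold Re, Im; simpl.
  auto_derive; trivial; ring.
Qed.

Lemma mode_solves_linearized_iff (vmin tau : R) (U h : R -> R) (vS k : R)
  (l V W : C) :
  C2_on (admissible vmin) U -> C2_on (admissible vmin) h ->
  admissible vmin vS ->
  mode_solves_linearized tau U h vS k l V W <->
  (l * V = Ci * RtoC k * W)%C /\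
  (l * W + RtoC (Derive h vS) * (l * V)
   = RtoC (/ tau) * (RtoC (Derive U vS) * V - W))%C.
Proof.
  intros hU hh hv; unfold mode_solves_linearized.
  rewrite (solves_linearized_iff vmin tau U h vS _ _ _ _ _ hU hh hv
    (is_derive_Re_mode_t k l V) (is_derive_Re_mode_t k l W)
    (is_derive_Re_mode_s k l W)).
  rewrite (solves_linearized_iff vmin tau U h vS _ _ _ _ _ hU hh hv
    (is_derive_Im_mode_t k l V) (is_derive_Im_mode_t k l W)
    (is_derive_Im_mode_s k l W)).
  split.
  (* At the origin the exponential equals 1, so the two real systems are the real and imaginary
     parts of the amplitude equations. *)
  - intros [HR HI]; specialize (HR 0 0); specialize (HI 0 0).
    rewrite !Re_mode in HR; rewrite !Im_mode in HI.
    rewrite !Rmult_0_r, Rplus_0_r, exp_0, cos_0, sin_0 in HR, HI.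
    destruct l as [a b], V as [V1 V2], W as [W1 W2].
    unfold Re, Im in *; simpl in *.
    split; unfold Cmult, Cplus, Cminus, Copp, RtoC, Ci; simpl; f_equal; lra.
  - intros [E1 E2].
    assert (Z : forall s t, mode k l 0 s t = 0%C) by (intros; unfold mode; ring).
    rewrite <- E1.
    (* Conversely, the momentum residual is itself a mode, with amplitude [d], and [d] vanishes by
       the second amplitude equation. *)
    set (d := (l * W + RtoC (Derive h vS) * (l * V)
               - RtoC (/ tau) * (RtoC (Derive U vS) * V - W))%C) in *.
    assert (Ed : d = 0%C) by (unfold d; rewrite E2; ring).
    split; intros s t; (split; [ring |]).
    + transitivity (Re (mode k l d s t)); [| rewrite Ed, Z; reflexivity].
      rewrite !Re_mode; unfold d; destruct l as [a b], V as [V1 V2], W as [W1 W2].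
      unfold Re, Im; simpl; ring.
    + transitivity (Im (mode k l d s t)); [| rewrite Ed, Z; reflexivity].
      rewrite !Im_mode; unfold d; destruct l as [a b], V as [V1 V2], W as [W1 W2].
      unfold Re, Im; simpl; ring.
Qed.

(** * Sign of the growth rate from the dispersion relation *)

Lemma Cmult_eq_0 (z w : C) : (z * w = 0)%C -> z = 0%C \/ w = 0%C.
Proof.
  intros e; destruct (Ceq_dec z 0) as [hz | hz]; [now left |].
  destruct (Ceq_dec w 0) as [hw | hw]; [now right |].
  now destruct (Cmult_neq_0 z w hz hw).
Qed.

Lemma linearly_stable_of_subcharacteristic (vmin tau : R) (U h : R -> R) (vS : R) :
  0 < tau ->
  C2_on (admissible vmin) U -> C2_on (admissible vmin) h ->
  admissible vmin vS ->
  0 < Derive U vS < - Derive h vS ->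
  linearly_stable tau U h vS.
Proof.
  intros htau hU hh hv hsub k l V W hk hVW hsol.
  apply (mode_solves_linearized_iff vmin) in hsol; trivial.
  destruct hsol as [E1 E2].
  assert (hik : (Ci * RtoC k)%C <> 0%C).
  { unfold Cmult, Ci, RtoC; simpl; intros e; injection e; intros; lra. }
  (* Multiplying the second amplitude equation by [i k] and replacing [i k W] by [l V] eliminates
     [W]. *)
  assert (D : ((l * l + RtoC (Derive h vS) * l * (Ci * RtoC k)
     + RtoC (/ tau) * (l - RtoC (Derive U vS) * (Ci * RtoC k))) * V = 0)%C).
  { transitivity (l * (l * V) + RtoC (Derive h vS) * (l * V) * (Ci * RtoC k)
      + RtoC (/ tau) * (l * V - RtoC (Derive U vS) * V * (Ci * RtoC k)))%C; [ring |].
    transitivity (Ci * RtoC k * (l * W + RtoC (Derive h vS) * (l * V)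
      - RtoC (/ tau) * (RtoC (Derive U vS) * V - W)))%C.
    - rewrite E1; ring.
    - rewrite E2; ring. }
  apply Cmult_eq_0 in D; destruct D as [D | hV].
  (* If [V = 0], the first equation gives [i k W = 0], hence [W = 0], and the mode is trivial. *)
  2:{ exfalso; apply hVW; rewrite hV in *.
      rewrite Cmult_0_r in E1; symmetry in E1; apply Cmult_eq_0 in E1.
      destruct E1 as [e | e]; [contradiction | now rewrite e]. }
  clear E1 E2 hVW V W hik.
  destruct l as [a b]; unfold Cmult, Cplus, Cminus, Copp, RtoC, Ci in D; simpl in D.
  injection D as D1 D2; unfold Re; simpl.
  destruct (Rlt_le_dec a 0) as [ha | ha]; [exact ha | exfalso].
  set (m := - Derive h vS) in *; set (w := Derive U vS) in *.
  assert (hm : Derive h vS = - m) by (unfold m; ring).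
  rewrite hm in D1, D2.
  assert (ht : 0 < / tau) by (apply Rinv_0_lt_compat; exact htau).
  set (r := / tau) in *.
  (* With [s = b / k] the two equations read
     [k^2 s (s - m) = a^2 + a r] and [a (2 s - m) = r (w - s)]. *)
  set (s := b / k).
  assert (hb : b = k * s) by (unfold s; field; exact hk).
  rewrite hb in D1, D2.
  assert (F1 : k * k * (s * (s - m)) = a * a + a * r) by lra.
  assert (F2 : a * (2 * s - m) = r * (w - s)).
  { apply Rmult_eq_reg_l with (2 := hk); lra. }
  assert (hk2 : 0 < k * k) by nra.
  assert (hs : 0 <= s * (s - m)).
  { apply Rmult_le_reg_l with (1 := hk2); rewrite F1; nra. }
  (* Since [s (s - m) >= 0], either [s >= m > w] or [s <= 0]. In [F2] the left side is then
     nonnegative and the right side negative, or the left side is nonpositive and the right side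
     positive. *)
  destruct (Rlt_le_dec 0 s) as [h0 | h0].
  - assert (m <= s) by nra. nra.
  - nra.
Qed.

(** A growing mode is found by solving the dispersion relation backwards: the phase speed is
    prescribed, and the growth rate and wave number follow. *)
Lemma linearly_unstable_of_supercharacteristic (vmin tau : R) (U h : R -> R) (vS : R) :
  0 < tau ->
  C2_on (admissible vmin) U -> C2_on (admissible vmin) h ->
  admissible vmin vS ->
  0 < - Derive h vS < Derive U vS ->
  linearly_unstable tau U h vS.
Proof.
  intros htau hU hh hv hsup hst.
  set (m := - Derive h vS) in *; set (w := Derive U vS) in *.
  assert (hm : Derive h vS = - m) by (unfold m; ring).
  (* Any [s] strictly between [m] and [w] makes [w - s], [2 s - m] and [s (s - m)] positive. The
     imaginary part of the dispersion relation then gives [a > 0], and the real part gives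
     [k^2 = q > 0]. *)
  set (s := (m + w) / 2).
  set (a := (w - s) / (tau * (2 * s - m))).
  set (q := (a * a + a / tau) / (s * (s - m))).
  assert (ha : 0 < a).
  { unfold a, s; apply Rdiv_lt_0_compat; [lra | apply Rmult_lt_0_compat; lra]. }
  assert (hs : 0 < s * (s - m)) by (apply Rmult_lt_0_compat; unfold s; lra).
  assert (hq : 0 < q).
  { unfold q; apply Rdiv_lt_0_compat; [| exact hs].
    apply Rplus_lt_0_compat; [nra | apply Rdiv_lt_0_compat; lra]. }
  set (k := sqrt q).
  assert (hk : 0 < k) by (apply sqrt_lt_R0; exact hq).
  assert (hk2 : k * k = q) by (apply sqrt_sqrt; lra).
  assert (F1 : k * k * (s * (s - m)) = a * a + a / tau).
  { rewrite hk2; unfold q; field; nra. }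
  assert (F2 : a * (2 * s - m) = (w - s) / tau).
  { unfold a; field; split; unfold s; lra. }
  pose (l := (a, k * s) : C).
  assert (hneg : Re l < 0).
  (* The amplitudes [V = i k], [W = l] satisfy the mass equation identically, which leaves only the
     dispersion relation. *)
  { apply (hst k l (Ci * RtoC k)%C l); [lra | |].
    - unfold l; intros e; apply (f_equal (fun p => fst (snd p))) in e.
      simpl in e; lra.
    - apply (mode_solves_linearized_iff vmin); trivial; split; [ring |].
      fold w; rewrite hm.
      unfold l, Cmult, Cplus, Cminus, Copp, RtoC, Ci; simpl; f_equal.
      + unfold Rdiv in F1; lra.
      + unfold Rdiv in F2. 
        apply (Rmult_eq_compat_l k) in F2; lra. }
  unfold Re, l in hneg; simpl in hneg; lra.
Qed.

(** * Calculus for C^1 functions on a closed segment *)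

Lemma C1_on_segment_near (a b : R) (f df : R -> R) (x eps : R) :
  C1_on_segment a b f df -> a <= x <= b -> 0 < eps ->
  exists delta, 0 < delta /\ forall y, a <= y <= b -> y <> x -> Rabs (y - x) < delta ->
    Rabs ((f y - f x) / (y - x) - df x) < eps.
Proof.
  intros hf hx heps.
  destruct (proj1 (hf x hx) eps heps) as (d & hd & H).
  exists d; split; [exact hd | intros y hy hne hyx].
  apply (H y); repeat split; trivial; try apply hy; auto.
Qed.

(** For [a <= b] this is the projection onto the segment. Composition with it extends a profile by
    constants to a continuous function on R, to which the mean value, intermediate value and maximum
    theorems apply. *)
Definition clamp (a b x : R) : R := Rmax a (Rmin x b).

Lemma clamp_bounds (a b x : R) : a <= b -> a <= clamp a b x <= b.
Proof.
  intros hab; unfold clamp; split; [apply Rmax_l |].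
  apply Rmax_lub; [exact hab | apply Rmin_r].
Qed.

Lemma clamp_id (a b x : R) : a <= x <= b -> clamp a b x = x.
Proof.
  intros hx; unfold clamp; rewrite Rmin_left, Rmax_right; lra.
Qed.

Lemma clamp_contraction (a b x y : R) :
  Rabs (clamp a b y - clamp a b x) <= Rabs (y - x).
Proof.
  unfold clamp, Rmax, Rmin, Rabs.
  repeat (destruct Rle_dec || destruct Rcase_abs); lra.
Qed.

Lemma C1_on_segment_clamp_continuous (a b : R) (f df : R -> R) (x : R) :
  a <= b -> C1_on_segment a b f df ->
  continuity_pt (fun y => f (clamp a b y)) x.
Proof.
  intros hab hf eps heps.
  pose proof (clamp_bounds a b x hab) as hc.
  destruct (cont_deriv _ _ _ _ (proj1 (hf _ hc)) eps heps) as (d & hd & H).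
  exists d; split; [exact hd | intros y [_ hy]].
  (* The limit defining continuity relative to the segment excludes the base point, while [clamp]
     may send a different [y] to it. *)
  destruct (Req_dec (clamp a b y) (clamp a b x)) as [e | ne].
  - rewrite e; simpl; unfold Rdist; rewrite Rminus_diag, Rabs_R0; exact heps.
  - apply H; split.
    + split; [apply clamp_bounds, hab | auto].
    + apply Rle_lt_trans with (2 := hy); apply clamp_contraction.
Qed.

Lemma C1_on_segment_is_derive (a b : R) (f df : R -> R) (x : R) :
  C1_on_segment a b f df -> a < x < b ->
  is_derive (fun y => f (clamp a b y)) x (df x).
Proof.
  intros hf hx.
  apply (is_derive_ext_loc f).
  { apply (locally_interval _ x a b); simpl; try apply hx.
    intros y h1 h2; rewrite clamp_id; [reflexivity | lra]. }
  apply is_derive_Reals; intros eps heps.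
  destruct (C1_on_segment_near a b f df x eps hf ltac:(lra) heps) as (d & hd & H).
  assert (hd' : 0 < Rmin d (Rmin (x - a) (b - x))).
  { repeat apply Rmin_pos; lra. }
  exists (mkposreal _ hd'); simpl; intros t ht ht'.
  assert (ht1 : Rabs t < d) by (apply Rlt_le_trans with (1 := ht'), Rmin_l).
  assert (ht2 : Rabs t < Rmin (x - a) (b - x))
    by (apply Rlt_le_trans with (1 := ht'), Rmin_r).
  pose proof (Rmin_l (x - a) (b - x)); pose proof (Rmin_r (x - a) (b - x)).
  assert (hb := Rabs_def2 _ _ ht2).
  specialize (H (x + t)); replace (x + t - x) with t in H by ring.
  apply H; [lra | lra | exact ht1].
Qed.

(** The mass equation says that [u - m v] has zero derivative, so the mean value theorem for the
    clamped extension applies. *)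
Lemma C1_on_segment_affine_constant (a b m : R) (v dv u du : R -> R) (x : R) :
  C1_on_segment a b v dv -> C1_on_segment a b u du ->
  (forall y, a <= y <= b -> m * dv y - du y = 0) ->
  a <= x <= b -> u x - m * v x = u a - m * v a.
Proof.
  intros hv hu hm hx.
  assert (hab : a <= b) by lra.
  destruct (MVT_gen (fun y => u (clamp a b y) - m * v (clamp a b y)) a x
              (fun y => du y - m * dv y)) as (c & hc & E).
  - rewrite Rmin_left, Rmax_right by lra; intros y hy.
    apply (is_derive_minus (fun y => u (clamp a b y)) (fun y => m * v (clamp a b y))).
    + apply C1_on_segment_is_derive with (1 := hu); lra.
    + apply is_derive_scal, C1_on_segment_is_derive with (1 := hv); lra.
  - intros y _.
    apply (continuity_pt_minus (fun y => u (clamp a b y)) (fun y => m * v (clamp a b y))).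
    + apply C1_on_segment_clamp_continuous with (2 := hu); exact hab.
    + apply (continuity_pt_scal (fun y => v (clamp a b y))).
      apply C1_on_segment_clamp_continuous with (2 := hv); exact hab.
  - rewrite Rmin_left, Rmax_right in hc by lra.
    rewrite !clamp_id in E by lra.
    assert (h0 := hm c ltac:(lra)).
    replace (du c - m * dv c) with 0 in E by lra; lra.
Qed.

(** * Convexity, and the necessary condition for a jamiton *)

Lemma is_derive_pos_lt (f df : R -> R) (a b : R) :
  a < b -> (forall c, a <= c <= b -> is_derive f c (df c)) ->
  (forall c, a < c < b -> 0 < df c) -> f a < f b.
Proof.
  intros hab hd hp.
  destruct (MVT_cor2 f df a b hab) as (c & E & hc).
  - intros c hc; apply is_derive_Reals, hd, hc.
  - assert (h := hp c hc); nra.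
Qed.

Lemma Derive_lt_of_convex (vmin : R) (f : R -> R) (a b : R) :
  C2_on (admissible vmin) f ->
  (forall v, admissible vmin v -> 0 < Derive_n f 2 v) ->
  admissible vmin a -> a < b -> Derive f a < Derive f b.
Proof.
  unfold admissible; intros hf hpos ha hab.
  apply (is_derive_pos_lt (Derive f) (Derive_n f 2) a b hab).
  - intros c hc; apply C2_on_is_derive2 with (1 := hf); unfold admissible; lra.
  - intros c hc; apply hpos; lra.
Qed.

Lemma Derive_gt_of_concave (vmin : R) (f : R -> R) (a b : R) :
  C2_on (admissible vmin) f ->
  (forall v, admissible vmin v -> Derive_n f 2 v < 0) ->
  admissible vmin a -> a < b -> Derive f b < Derive f a.
Proof.
  unfold admissible; intros hf hneg ha hab.
  apply Ropp_lt_cancel.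
  apply (is_derive_pos_lt (fun v => - Derive f v) (fun v => - Derive_n f 2 v) a b hab).
  - intros c hc; apply (is_derive_opp (Derive f)).
    apply C2_on_is_derive2 with (1 := hf); unfold admissible; lra.
  - intros c hc; assert (h := hneg c ltac:(lra)); lra.
Qed.

Lemma is_derive_affine_plus (f : R -> R) (m c x l : R) :
  is_derive f x l -> is_derive (fun y => f y + m * y + c) x (l + m).
Proof.
  intros hf.
  assert (hl : is_derive (fun y => m * y + c) x m) by (auto_derive; trivial; ring).
  apply (is_derive_ext (fun y => f y + (m * y + c))); [intros y; simpl; ring |].
  exact (is_derive_plus _ _ _ _ _ hf hl).
Qed.

(** By convexity, [h v - h'(vS) v] strictly decreases up to [vS] and strictly increases after it, so
    two points with equal values cannot lie on the same side of [vS]. *)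
Lemma sonic_between (vmin : R) (h : R -> R) (vS vp vm : R) :
  C2_on (admissible vmin) h ->
  (forall v, admissible vmin v -> 0 < Derive_n h 2 v) ->
  admissible vmin vS -> admissible vmin vp -> vp < vm ->
  h vp - Derive h vS * vp = h vm - Derive h vS * vm ->
  vp < vS < vm.
Proof.
  unfold admissible; intros hh hh2 hS hp hpm E.
  split; apply Rnot_le_lt; intros hle.
  (* The summand 0 gives the expression the shape required by [is_derive_affine_plus]. *)
  - enough (h vp + (- Derive h vS) * vp + 0 < h vm + (- Derive h vS) * vm + 0) by lra.
    apply (is_derive_pos_lt (fun y => h y + (- Derive h vS) * y + 0)
             (fun y => Derive h y + (- Derive h vS)) vp vm hpm).
    + intros c hc; apply is_derive_affine_plus.
      apply C2_on_is_derive with (1 := hh); unfold admissible; lra.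
    + intros c hc; assert (Derive h vS < Derive h c); [| lra].
      apply (Derive_lt_of_convex vmin); unfold admissible; trivial; lra.
  - enough (- h vp + Derive h vS * vp + 0 < - h vm + Derive h vS * vm + 0) by lra.
    apply (is_derive_pos_lt (fun y => - h y + Derive h vS * y + 0)
             (fun y => - Derive h y + Derive h vS) vp vm hpm).
    + intros c hc; apply (is_derive_affine_plus (fun y => - h y)), (is_derive_opp h).
      apply C2_on_is_derive with (1 := hh); unfold admissible; lra.
    + intros c hc; assert (Derive h c < Derive h vS); [| lra].
      apply (Derive_lt_of_convex vmin); unfold admissible; trivial; lra.
Qed.

Lemma jamiton_supercharacteristic (vmin : R) (U h : R -> R) (vS : R) :
  C2_on (admissible vmin) U -> C2_on (admissible vmin) h ->
  (forall v, admissible vmin v -> Derive_n U 2 v < 0) ->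
  (forall v, admissible vmin v -> 0 < Derive_n h 2 v) ->
  admissible vmin vS ->
  jamiton_exists vmin U h vS -> - Derive h vS <= Derive U vS.
Proof.
  intros hU hh hU2 hh2 hS (m & a & b & v & u & dv & du & J).
  destruct J as [mpos sonic hab hv hu hadm mass mom rh1 rh2 lax].
  apply Rnot_lt_le; intros hsub; rewrite sonic in hsub.
  assert (adma := hadm a ltac:(lra)).
  assert (hSb : v a < vS < v b).
  { apply (sonic_between vmin h); trivial; rewrite sonic; lra. }
  assert (haff : forall x, a <= x <= b -> u x - m * v x = u a - m * v a).
  { intros x; apply (C1_on_segment_affine_constant a b m v dv u du); trivial. }
  assert (hvc : forall x, continuity_pt (fun y => v (clamp a b y)) x).
  { intros x; apply C1_on_segment_clamp_continuous with (2 := hv); lra. }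
  (* The profile passes through [vS], where [m + h'(v) = 0] removes the derivatives from the
     momentum equation and leaves [u = U vS]. *)
  assert (hc : U vS - m * vS = u a - m * v a).
  { destruct (f_interv_is_interv (fun y => v (clamp a b y)) a b vS hab)
      as (x & hx & E);
      [cbv beta; rewrite !clamp_id by lra; lra | intros; apply hvc |].
    cbv beta in E; rewrite clamp_id in E by exact hx.
    rewrite <- (haff x hx), E.
    assert (h0 := mom x hx); rewrite E, sonic in h0.
    assert (h1 : du x = m * dv x) by (specialize (mass x hx); lra).
    rewrite h1 in h0; lra. }
  (* Beyond [vS], concavity gives [U' < U'(vS) < m], so the right side of the profile equation is
     negative, while the coefficient [m (m + h'(v))] of [v'] is positive. *)
  assert (hdec : forall x, a <= x <= b -> vS < v x -> dv x < 0).
  { intros x hx hSx.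
    assert (hw : U (v x) - m * v x < U vS - m * vS).
    { enough (- U vS + m * vS + 0 < - U (v x) + m * v x + 0) by lra.
      apply (is_derive_pos_lt (fun y => - U y + m * y + 0)
               (fun y => - Derive U y + m) _ _ hSx).
      - intros c hcx; apply (is_derive_affine_plus (fun y => - U y)), (is_derive_opp U).
        apply C2_on_is_derive with (1 := hU); unfold admissible in *; lra.
      - intros c hcx; assert (Derive U c < Derive U vS); [| lra].
        apply (Derive_gt_of_concave vmin); trivial; lra. }
    assert (hr : Derive h vS < Derive h (v x))
      by (apply (Derive_lt_of_convex vmin); trivial).
    assert (h0 := mom x hx); assert (h2 := haff x hx).
    assert (h1 : du x = m * dv x) by (specialize (mass x hx); lra).
    rewrite h1 in h0; rewrite sonic in hr.
    assert (E : m * (m + Derive h (v x)) * dv x < 0) by lra.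
    assert (0 < m * (m + Derive h (v x))) by nra.
    nra. }
  (* At a maximum point, [v x >= v b > vS] forces [dv x < 0]. Since [v a < vS], the point is not
     [a]; it may be [b], so only points to its left are used for the contradiction. *)
  destruct (continuity_ab_maj (fun y => v (clamp a b y)) a b) as (x & hmax & hx);
    [lra | auto |].
  assert (hxb := hmax b ltac:(lra)); cbv beta in hxb; rewrite !clamp_id in hxb by lra.
  assert (hdx := hdec x hx ltac:(lra)).
  assert (hax : a < x).
  { destruct (Req_dec a x) as [e |]; [subst x; lra | lra]. }
  (* The tolerance [- dv x] makes difference quotients near [x] negative, whereas maximality makes
     those from the left nonnegative. *)
  destruct (C1_on_segment_near a b v dv x (- dv x) hv hx ltac:(lra)) as (d & hd & H).
  set (y := Rmax a (x - d / 2)).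
  assert (hy : a <= y < x /\ x - y < d).
  { unfold y, Rmax; destruct Rle_dec; lra. }
  specialize (H y ltac:(lra) ltac:(lra)).
  rewrite Rabs_left in H by lra; specialize (H ltac:(lra)).
  apply Rabs_def2 in H.
  assert (hyx := hmax y ltac:(lra)); cbv beta in hyx; rewrite !clamp_id in hyx by lra.
  assert (0 <= (v y - v x) / (y - x)); [| lra].
  replace ((v y - v x) / (y - x)) with ((v x - v y) / (x - y)) by (field; lra).
  apply Rdiv_le_0_compat; lra.
Qed.

(** * Construction of a jamiton in the supercharacteristic case *)

Lemma C1_on_segment_intro (a b : R) (f df : R -> R) :
  (forall x, a <= x <= b -> derivable_pt_lim f x (df x)) ->
  (forall x, a <= x <= b -> continuity_pt df x) ->
  C1_on_segment a b f df.
Proof.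
  intros hd hc x hx; split.
  - apply (D_in_imp _ _ no_cond); [intros; exact Logic.I |].
    apply derivable_pt_lim_D_in, hd, hx.
  - intros eps heps; destruct (hc x hx eps heps) as (d & hd' & H).
    exists d; split; [exact hd' | intros y [[_ hy] hyx]].
    apply H; repeat split; trivial.
Qed.

(** This turns [chi] as a function of [v] into the profile [v] as a function of [chi]. *)
Lemma inverse_of_increasing (G g : R -> R) (lb ub : R) :
  lb < ub -> (forall x, lb <= x <= ub -> is_derive G x (g x)) ->
  (forall x, lb <= x <= ub -> 0 < g x) ->
  exists V : R -> R,
    (forall x, lb <= x <= ub -> V (G x) = x) /\
    (forall y, G lb <= y <= G ub -> lb <= V y <= ub) /\
    (forall y, G lb < y < G ub -> derivable_pt_lim V y (/ g (V y))).
Proof.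
  intros hlu hd hpos.
  assert (hinc : forall x y, lb <= x -> x < y -> y <= ub -> G x < G y).
  { intros x y hx hxy hy; apply (is_derive_pos_lt G g x y hxy);
      intros; [apply hd | apply hpos]; lra. }
  assert (hG := hinc lb ub ltac:(lra) hlu ltac:(lra)).
  assert (hder : forall x, lb <= x <= ub -> derivable_pt G x).
  { intros x hx; exists (g x); apply is_derive_Reals, hd, hx. }
  (* The intermediate value theorem returns an explicit witness, so [V] needs no choice. Clamping
     [y] makes its hypothesis hold for every real [y], hence [V] is total. *)
  pose (P y := f_interv_is_interv G lb ub (clamp (G lb) (G ub) y) hlu
    (clamp_bounds _ _ y (Rlt_le _ _ hG))
    (fun x hx => derivable_continuous_pt _ _ (hder x hx))).
  pose (V y := proj1_sig (P y)).
  assert (hV : forall y, G lb <= y -> y <= G ub -> lb <= V y <= ub).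
  { intros y _ _; exact (proj1 (proj2_sig (P y))). }
  assert (hGV : forall y, G lb <= y -> y <= G ub -> comp G V y = id y).
  { intros y h1 h2; unfold comp, V; rewrite (proj2 (proj2_sig (P y))).
    apply clamp_id; split; assumption. }
  assert (hVG := leftinv_is_rightinv_interv G V lb ub hinc hGV hV).
  unfold comp, id in hVG.
  exists V; split; [| split].
  - intros x hx; apply hVG; lra.
  - intros y hy; apply hV; lra.
  - intros y hy.
    assert (hVy : V (G lb) <= V y <= V (G ub))
      by (rewrite !hVG by lra; apply hV; lra).
    assert (Prf : forall a, V (G lb) <= a <= V (G ub) -> derivable_pt G a)
      by (intros a; rewrite !hVG by lra; apply hder).
    assert (E : derive_pt G (V y) (Prf (V y) hVy) = g (V y)).
    { apply derive_pt_eq_0, is_derive_Reals, hd, hV; lra. }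
    assert (hne : derive_pt G (V y) (Prf (V y) hVy) <> 0).
    { rewrite E; apply Rgt_not_eq, hpos, hV; lra. }
    rewrite <- E, <- (Rmult_1_l (/ _)).
    apply derivable_pt_lim_recip_interv with (lb := G lb) (ub := G ub); trivial.
    + apply (continuity_pt_recip_interv G V lb ub hlu hinc hGV hV); trivial.
      intros a ha; apply derivable_continuous_pt, hder, ha.
    + intros x hx; apply hGV; lra.
Qed.

(** The difference quotient of [f] at [x0], extended by [l = f'(x0)] at [x0]. *)
Definition slope (f : R -> R) (l x0 x : R) : R :=
  if Req_dec_T x x0 then l else (f x - f x0) / (x - x0).

Lemma slope_spec (f : R -> R) (l x0 x : R) :
  f x - f x0 = slope f l x0 x * (x - x0).
Proof.
  unfold slope; destruct Req_dec_T as [-> |]; [ring | field; lra].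
Qed.

(** At [x0] continuity is the definition of the derivative; elsewhere the function is locally a
    quotient of continuous functions. *)
Lemma slope_continuous (f : R -> R) (l l' x0 x : R) :
  is_derive f x0 l -> is_derive f x l' -> continuity_pt (slope f l x0) x.
Proof.
  intros h0 hx; destruct (Req_dec x x0) as [-> | hne].
  - apply is_derive_Reals in h0; intros eps heps.
    destruct (h0 eps heps) as (d & H); exists d; split; [apply cond_pos |].
    intros y [[_ hy] hyd]; simpl; unfold Rdist, slope.
    destruct (Req_dec_T x0 x0) as [_ |]; [| contradiction].
    destruct (Req_dec_T y x0) as [e |]; [congruence |].
    specialize (H (y - x0)); replace (x0 + (y - x0)) with y in H by (simpl in *; ring).
    apply H; [lra | exact hyd].
  - apply (continuity_pt_ext_loc (fun y => (f y - f x0) / (y - x0))).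
    + generalize (open_neq x0 x hne); apply filter_imp; intros y hy.
      unfold slope; destruct Req_dec_T; [contradiction | reflexivity].
    + apply continuity_pt_div.
      * apply (continuity_pt_minus f (fun _ => f x0)).
        -- apply derivable_continuous_pt; exists l'; apply is_derive_Reals, hx.
        -- apply continuity_pt_const; intros ? ?; reflexivity.
      * apply (continuity_pt_minus id (fun _ => x0));
          [apply derivable_continuous_pt, derivable_pt_id |
           apply continuity_pt_const; intros ? ?; reflexivity].
      * lra.
Qed.

Lemma slope_pos (f df : R -> R) (a b x0 x : R) :
  a < x0 < b -> a < x < b ->
  (forall y, a < y < b -> is_derive f y (df y)) ->
  (forall y, a < y < b -> 0 < df y) -> 0 < slope f (df x0) x0 x.
Proof.
  intros h0 hx hd hp; unfold slope; destruct Req_dec_T as [e | ne].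
  - apply hp, h0.
  - destruct (Rdichotomy _ _ ne) as [hlt | hgt].
    + replace ((f x - f x0) / (x - x0)) with ((f x0 - f x) / (x0 - x)) by (field; lra).
      apply Rdiv_lt_0_compat; [| lra]; apply Rlt_0_minus.
      apply (is_derive_pos_lt f df); trivial; intros; [apply hd | apply hp]; lra.
    + apply Rdiv_lt_0_compat; [| lra]; apply Rlt_0_minus.
      apply (is_derive_pos_lt f df); trivial; intros; [apply hd | apply hp]; lra.
Qed.

Lemma is_derive_RInt_interval (g : R -> R) (a b x0 x : R) :
  a < x0 < b -> a < x < b ->
  (forall y, a < y < b -> continuity_pt g y) ->
  is_derive (RInt g x0) x (g x).
Proof.
  intros h0 hx hg; apply is_derive_RInt with (a := x0).
  - apply (locally_interval _ x a b); simpl; try apply hx.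
    intros y h1 h2; apply (RInt_correct (V := R_CompleteNormedModule)).
    apply (ex_RInt_continuous (V := R_CompleteNormedModule)).
    intros z hz; apply continuity_pt_filterlim, hg.
    revert hz; unfold Rmin, Rmax; destruct Rle_dec; lra.
  - apply continuity_pt_filterlim, hg, hx.
Qed.

(** The intermediate value theorem is applied on both sides of [x0] at a common level. The two
    points serve as the states joined by the shock. *)
Lemma equal_levels_around_minimum (f : R -> R) (lb x0 ub : R) :
  lb < x0 < ub -> (forall x, lb <= x <= ub -> continuity_pt f x) ->
  f x0 < f lb -> f x0 < f ub ->
  exists a b, lb < a < x0 /\ x0 < b < ub /\ f a = f b.
Proof.
  intros h0 hc h1 h2.
  pose proof (Rmin_l (f lb) (f ub)); pose proof (Rmin_r (f lb) (f ub)).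
  pose proof (Rmin_pos (f lb - f x0) (f ub - f x0) ltac:(lra) ltac:(lra)).
  (* A level strictly between [f x0] and both end values keeps the crossings away from [lb], [x0]
     and [ub]. *)
  set (y := (f x0 + Rmin (f lb) (f ub)) / 2).
  assert (hy : f x0 < y < Rmin (f lb) (f ub)).
  { unfold y, Rmin in *; destruct Rle_dec; lra. }
  (* The theorem expects the smaller value at the left end, hence the change of sign on this
     side. *)
  destruct (f_interv_is_interv (fun x => - f x) lb x0 (- y)) as (a & ha & Ea);
    [lra | lra | intros; apply (continuity_pt_opp f), hc; lra |].
  destruct (f_interv_is_interv f x0 ub y) as (b & hb & Eb);
    [lra | lra | intros; apply hc; lra |].
  assert (a <> lb) by (intros ->; lra). assert (a <> x0) by (intros ->; lra).
  assert (b <> ub) by (intros ->; lra). assert (b <> x0) by (intros ->; lra).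
  exists a, b; lra.
Qed.

Lemma jamiton_of_supercharacteristic (vmin : R) (U h : R -> R) (vS : R) :
  C2_on (admissible vmin) U -> C2_on (admissible vmin) h ->
  (forall v, admissible vmin v -> 0 < Derive_n h 2 v) ->
  admissible vmin vS ->
  0 < - Derive h vS < Derive U vS -> jamiton_exists vmin U h vS.
Proof.
  intros hU hh hh2 hS hsup.
  set (m := - Derive h vS) in *.
  assert (hm : Derive h vS = - m) by (unfold m; ring).
  assert (hloc : locally vS (fun v => admissible vmin v /\ m < Derive U v)).
  { apply filter_and; [exact (open_gt vmin vS hS) |].
    assert (hc : continuous (Derive U) vS).
    { apply (ex_derive_continuous (K := R_AbsRing) (V := R_NormedModule)).
      exact (proj1 (proj2 (hU vS hS))). }
    apply (hc (fun y => m < y)), open_gt; lra. }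
  destruct hloc as (d & hd); pose proof (cond_pos d) as dpos.
  set (a := vS - d) in *; set (b := vS + d) in *.
  assert (hJ : forall v, a < v < b -> admissible vmin v /\ m < Derive U v).
  { intros v hv; apply hd; apply Rabs_def1; unfold minus, plus, opp; simpl;
      unfold a, b in hv; lra. }
  clear hd.
  assert (h0 : a < vS < b) by (unfold a, b; lra).
  (* Half the radius places [[lb, ub]] inside the open interval [(a, b)], so two-sided derivatives
     are available at its ends. *)
  set (lb := vS - d / 2); set (ub := vS + d / 2).
  assert (hlb : a < lb < vS) by (unfold a, lb; lra).
  assert (hub : vS < ub < b) by (unfold b, ub; lra).
  clearbody a b lb ub.
  assert (dh : forall v, a < v < b -> is_derive (Derive h) v (Derive_n h 2 v)).
  { intros v hv; apply C2_on_is_derive2 with (1 := hh); apply hJ, hv. }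
  set (w v := U v + - m * v + 0).
  assert (dw : forall v, a < v < b -> is_derive w v (Derive U v + - m)).
  { intros v hv; apply is_derive_affine_plus.
    apply C2_on_is_derive with (1 := hU); apply hJ, hv. }
  set (sh := slope (Derive h) (Derive_n h 2 vS) vS).
  set (sw := slope w (Derive U vS + - m) vS).
  assert (hsh : forall v, a < v < b -> 0 < sh v).
  { intros v hv; apply (slope_pos (Derive h) (Derive_n h 2) a b); trivial.
    intros y hy; apply hh2, hJ, hy. }
  assert (hsw : forall v, a < v < b -> 0 < sw v).
  { intros v hv; apply (slope_pos w (fun v => Derive U v + - m) a b); trivial.
    intros y hy; assert (hy' := proj2 (hJ y hy)); lra. }
  (* With [u = m v + U vS - m vS] the profile equations reduce to
     [m (m + h'(v)) v' = w v - w vS]; both sides vanish to first order at [vS],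
     and [chi] as a function of [v] has derivative [g]. *)
  set (g v := m * sh v / sw v).
  assert (hg : forall v, a < v < b -> 0 < g v).
  { intros v hv; apply Rdiv_lt_0_compat; [apply Rmult_lt_0_compat |]; auto; lra. }
  assert (hgc : forall v, a < v < b -> continuity_pt g v).
  { intros v hv; apply (continuity_pt_div (fun v => m * sh v) sw).
    - apply (continuity_pt_scal sh), (slope_continuous _ _ _ _ _ (dh vS h0) (dh v hv)).
    - apply (slope_continuous _ _ _ _ _ (dw vS h0) (dw v hv)).
    - apply Rgt_not_eq, hsw, hv. }
  assert (dr : forall v, a < v < b ->
    is_derive (fun v => h v + m * v + 0) v (Derive h v + m)).
  { intros v hv; apply is_derive_affine_plus.
    apply C2_on_is_derive with (1 := hh); apply hJ, hv. }
  (* Equality of [h v + m v] at [vp] and [vm] is the momentum jump condition once [u = m v + c]. *)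
  destruct (equal_levels_around_minimum (fun v => h v + m * v + 0) lb vS ub)
    as (vp & vm & hvp & hvm & E).
  { lra. }
  { intros v hv; apply derivable_continuous_pt; exists (Derive h v + m).
    apply is_derive_Reals, dr; lra. }
  { enough (- h lb + - m * lb + 0 < - h vS + - m * vS + 0) by lra.
    apply (is_derive_pos_lt (fun v => - h v + - m * v + 0)
             (fun v => - Derive h v + - m)); [lra | |]; intros v hv.
    - apply (is_derive_affine_plus (fun v => - h v)), (is_derive_opp h).
      apply C2_on_is_derive with (1 := hh); apply hJ; lra.
    - assert (Derive h v < Derive h vS); [| lra].
      apply (Derive_lt_of_convex vmin); trivial; [apply hJ; lra | lra]. }
  { apply (is_derive_pos_lt (fun v => h v + m * v + 0)
             (fun v => Derive h v + m)); [lra | |]; intros v hv.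
    - apply dr; lra.
    - assert (Derive h vS < Derive h v); [| lra].
      apply (Derive_lt_of_convex vmin); trivial; lra. }
  (* Integrating from [vS] places the sonic point at [chi = 0]. *)
  set (G := RInt g vS).
  assert (dG : forall v, a < v < b -> is_derive G v (g v)).
  { intros v hv; apply (is_derive_RInt_interval g a b); trivial. }
  destruct (inverse_of_increasing G g lb ub) as (V & hVG & hV & dV);
    [lra | intros; apply dG; lra | intros; apply hg; lra |].
  assert (hG : forall x y, lb <= x -> x < y -> y <= ub -> G x < G y).
  { intros x y hx hxy hy; apply (is_derive_pos_lt G g x y hxy);
      intros; [apply dG | apply hg]; lra. }
  (* The profile interval [[G vp, G vm]] lies strictly inside [(G lb, G ub)], where the inverse [V]
     is differentiable. *)
  assert (G1 := hG lb vp ltac:(lra) ltac:(lra) ltac:(lra)).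
  assert (G2 := hG vp vm ltac:(lra) ltac:(lra) ltac:(lra)).
  assert (G3 := hG vm ub ltac:(lra) ltac:(lra) ltac:(lra)).
  assert (hVJ : forall x, G vp <= x <= G vm -> a < V x < b).
  { intros x hx; assert (hx' := hV x ltac:(lra)); lra. }
  set (dv x := / g (V x)).
  assert (hdv : forall x, G vp <= x <= G vm -> derivable_pt_lim V x (dv x))
    by (intros; apply dV; lra).
  assert (hdvc : forall x, G vp <= x <= G vm -> continuity_pt dv x).
  { intros x hx; apply (continuity_pt_inv (fun x => g (V x))).
    - apply (continuity_pt_comp V g).
      + apply derivable_continuous_pt; exists (dv x); apply hdv, hx.
      + apply hgc, hVJ, hx.
    - apply Rgt_not_eq, hg, hVJ, hx. }
  exists m, (G vp), (G vm), V, (fun x => m * V x + (U vS - m * vS)), dv,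
    (fun x => m * dv x).
  split; trivial.
  - lra.
  - apply C1_on_segment_intro; trivial.
  - apply C1_on_segment_intro.
    + intros x hx; rewrite <- (Rplus_0_r (m * dv x)).
      apply (derivable_pt_lim_plus (fun x => m * V x) (fun _ => U vS - m * vS)).
      * apply (derivable_pt_lim_scal V), hdv, hx.
      * apply derivable_pt_lim_const.
    + intros x hx; apply (continuity_pt_scal dv), hdvc, hx.
  - intros x hx; apply hJ, hVJ, hx.
  - intros; ring.
  - intros x hx; assert (hx' := hVJ x hx).
    (* Both sides of the profile equation contain the factor [V x - vS]; the cofactors agree because
       [dv = sw / (m sh)]. No division by [V x - vS] occurs, so the sonic point is covered. *)
    assert (E1 := slope_spec (Derive h) (Derive_n h 2 vS) vS (V x)).
    assert (E2 := slope_spec w (Derive U vS + - m) vS (V x)).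
    fold sh in E1; fold sw in E2; unfold w in E2.
    assert (p1 := hsh _ hx'); assert (p2 := hsw _ hx').
    transitivity (m * (Derive h (V x) + m) * dv x); [ring |].
    replace (Derive h (V x) + m) with (sh (V x) * (V x - vS)) by lra.
    transitivity (sw (V x) * (V x - vS)); [| lra].
    unfold dv, g; field; lra.
  - rewrite !hVG by lra; ring.
  - rewrite !hVG by lra; lra.
  - rewrite !hVG by lra; lra.
Qed.

Theorem theorem3 (vmin tau : R) (U h : R -> R) (vS mS : R)
  (hvmin : 0 <= vmin) (htau : 0 < tau)
  (hU : C2_on (admissible vmin) U) (hh : C2_on (admissible vmin) h)
  (hU1 : forall v, admissible vmin v -> 0 < Derive U v)
  (hU2 : forall v, admissible vmin v -> Derive_n U 2 v < 0)
  (hh1 : forall v, admissible vmin v -> Derive h v < 0)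
  (hh2 : forall v, admissible vmin v -> 0 < Derive_n h 2 v)
  (hvS : admissible vmin vS)
  (hmS : mS = - Derive h vS)
  (hnondeg : Derive U vS <> mS) :
  jamiton_exists vmin U h vS <-> linearly_unstable tau U h vS.
Proof.
  assert (hm : 0 < - Derive h vS) by (specialize (hh1 vS hvS); lra).
  split; intros H.
  - apply (linearly_unstable_of_supercharacteristic vmin); trivial.
    (* Non-degeneracy makes this inequality strict. *)
    assert (hle := jamiton_supercharacteristic vmin U h vS hU hh hU2 hh2 hvS H); lra.
  - destruct (Rlt_le_dec (- Derive h vS) (Derive U vS)) as [hlt | hle].
    + apply jamiton_of_supercharacteristic; trivial; lra.
    + exfalso; apply H.
      apply (linearly_stable_of_subcharacteristic vmin); trivial.
      specialize (hU1 vS hvS); lra.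
Qed.
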